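(* Let $m\in\{0,1\}$. Then $$\lim_{X\to+\infty}\frac{\#\{0\le n\le X:\ \mathcal{J}^*_{6}(3^m(8n+1))\equiv 0 \pmod 2\}}{X}=1.$$
   Context: Let $q=e^{2\pi i\tau}$, $\tau$ in the upper half-plane, and $(a;q)_\infty=\prod_{j\ge0}(1-aq^j)$. The Dedekind eta function is $\eta(\tau)=q^{1/24}(q;q)_\infty$. The Hauptmodul $j_6^*$ of the Fricke group $\Gamma_0^*(6)$ is $$j_6^{*}(\tau)=\left(\frac{\eta(\tau)\eta(3\tau)}{\eta(2\tau)\eta(6\tau)}\right)^6+6+2^6\left(\frac{\eta(2\tau)\eta(6\tau)}{\eta(\tau)\eta(3\tau)}\right)^6 = \frac1q+\sum_{n\ge 0}\mathcal{J}^*_6(n)q^n,$$ which defines the integers $\mathcal{J}^*_6(n)$. *)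

(* Defs.v *)
From HB Require Import structures.
From mathcomp Require Import all_boot all_order all_algebra.
From mathcomp Require Import all_classical all_reals all_analysis.
Set Implicit Arguments. Unset Strict Implicit. Unset Printing Implicit Defensive.
Import Order.TTheory GRing.Theory Num.Theory.
Local Open Scope ring_scope.

(* Formal power series in q with integer coefficients: n |-> coefficient of q^n. *)
Definition ps := nat -> int.

Definition ps_one : ps := fun n => if n == 0%N then 1 else 0.

Definition ps_mul (f g : ps) : ps :=
  fun n => \sum_(i < n.+1) f i * g (n - i)%N.

Definition ps_exp (f : ps) (e : nat) : ps := iter e (ps_mul f) ps_one.

(* 1 - q^k  (k >= 1) *)
Definition ps_onem (k : nat) : ps :=
  fun n => if n == 0%N then 1 else if n == k then -1 else 0.

(* 1 / (1 - q^k) = sum_{m>=0} q^(k m)  (k >= 1) *)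
Definition ps_geom (k : nat) : ps := fun n => if (k %| n)%N then 1 else 0.

(* j-th factor of  P(q) = ((q;q)(q^3;q^3) / ((q^2;q^2)(q^6;q^6)))^6 *)
Definition P_factor (j : nat) : ps :=
  ps_mul (ps_mul (ps_exp (ps_onem j) 6) (ps_exp (ps_onem (3 * j)) 6))
         (ps_mul (ps_exp (ps_geom (2 * j)) 6) (ps_exp (ps_geom (6 * j)) 6)).

Definition Pinv_factor (j : nat) : ps :=
  ps_mul (ps_mul (ps_exp (ps_geom j) 6) (ps_exp (ps_geom (3 * j)) 6))
         (ps_mul (ps_exp (ps_onem (2 * j)) 6) (ps_exp (ps_onem (6 * j)) 6)).

Definition ps_prod (F : nat -> ps) (N : nat) : ps :=
  foldr (fun j acc => ps_mul (F j) acc) ps_one (iota 1 N).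

(* The coefficient of q^n only depends on the factors with j <= n. *)
Definition Pcoef (n : nat) : int := ps_prod P_factor n n.
Definition Pinvcoef (n : nat) : int := ps_prod Pinv_factor n n.

(* eta(t)eta(3t)/(eta(2t)eta(6t)) = q^(-1/6) * (q;q)(q^3;q^3)/((q^2;q^2)(q^6;q^6)),
   hence  j6*(t) = q^{-1} P(q) + 6 + 64 q / P(q)  =  1/q + sum_{n>=0} J6 n q^n
   where J6 n = [q^(n+1)] P + 6 [n = 0] + 64 [q^(n-1)] (1/P)  ([.]=0 if n=0). *)
Definition J6star (n : nat) : int :=
  Pcoef n.+1 + (if n == 0%N then 6 else 0) + (if n == 0%N then 0 else 64 * Pinvcoef n.-1).

(* Main.v *)
Require Import Defs.
From HB Require Import structures.
From mathcomp Require Import all_boot all_order all_algebra.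
From mathcomp Require Import all_classical all_reals all_analysis.
From mathcomp Require Import ring lra zify.
Import Order.TTheory GRing.Theory Num.Theory.
Import numFieldNormedType.Exports.
Local Open Scope classical_set_scope.
Local Open Scope ring_scope.
Set Implicit Arguments. Unset Strict Implicit. Unset Printing Implicit Defensive.

(* Modulo 2 the second eta quotient disappears from j6*, and the first one is
   q^-1 (f(q) f(q^3))^-6 with f(q) = (q;q).  By Gauss, f^3 = psi modulo 2, where
   psi = sum_a q^(a(a+1)/2); hence q j6* = U^2 with U = 1/(psi psi3), psi3 = psi(q^3).
   An involution on the representations by x^2 + 3 y^2 gives
   psi psi3 = psi^4 + q psi3^4.  Put V = psi3/psi, so that 1/V = psi/psi3.  Then
   U = 1/V^2 + q V^2 and V = psi^2 + q (psi V^2)^2, and the part of 1/V with exponents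
   1 modulo 3 is q V(q^3).  Reading off coefficients (squaring is q |-> q^2), for both
   values of m the coefficient J(3^m (8t+1)) is odd exactly when t is triangular, and
   triangular numbers have density 0. *)

(** * Triangular numbers *)

Definition tri (a : nat) : nat := (a * a.+1)./2.
Arguments tri _ : simpl never.

Lemma tri_double a : ((tri a).*2 = a * a.+1)%N.
Proof. by rewrite /tri -[RHS]odd_double_half oddM /= andbN. Qed.

Lemma leq_tri a : (a <= tri a)%N.
Proof. have := tri_double a; case: a => [|a]; nia. Qed.

Lemma ltn_tri a b : (a < b -> tri a < tri b)%N.
Proof. have := tri_double a; have := tri_double b; nia. Qed.

Lemma tri_inj : injective tri.
Proof.
move=> a b ab; case: (ltngtP a b) => // /ltn_tri; rewrite ab ltnn //.
Qed.

(** Splitting the index by its residue modulo 3 shows that a triangular number is 1 modulo 3 only at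
    an index [3 * b + 1], where it equals [9 * tri b + 1]. The 3-dissection of 1/V rests on this. *)
Lemma tri3 b : (tri (3 * b) + 3 * b = 9 * tri b)%N.
Proof. have := tri_double (3 * b); have := tri_double b; nia. Qed.

Lemma tri3S b : (tri (3 * b).+1 = (9 * tri b).+1)%N.
Proof. have := tri_double (3 * b).+1; have := tri_double b; nia. Qed.

Lemma tri3SS b : (tri (3 * b).+2 = 9 * tri b + 3 * b + 3)%N.
Proof. have := tri_double (3 * b).+2; have := tri_double b; nia. Qed.

Lemma mod3_cases a : exists b, a = (3 * b)%N \/ a = (3 * b).+1 \/ a = (3 * b).+2.
Proof. by exists (a %/ 3)%N; lia. Qed.

Definition is_tri k := [exists a : 'I_k.+1, tri a == k].

Lemma is_triP k : reflect (exists a, tri a = k) (is_tri k).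
Proof.
apply: (iffP existsP) => [[a /eqP <-]|[a ak]]; first by exists a.
have lt_a : (a < k.+1)%N by rewrite ltnS -ak leq_tri.
by exists (Ordinal lt_a); rewrite /= ak.
Qed.

(** * Congruence of polynomials modulo a power of X *)

(** Congruence modulo ['X^n]: power series are handled as truncated polynomials, so that ring
    identities remain available. *)
Definition eqm (R : comNzRingType) n (p q : {poly R}) :=
  forall i, (i < n)%N -> p`_i = q`_i.

Lemma eqm_refl (R : comNzRingType) n (p : {poly R}) : eqm n p p.
Proof. by []. Qed.

Lemma eqm_sym (R : comNzRingType) n (p q : {poly R}) : eqm n p q -> eqm n q p.
Proof. by move=> pq i /pq. Qed.

Lemma eqm_trans (R : comNzRingType) n (q p r : {poly R}) :
  eqm n p q -> eqm n q r -> eqm n p r.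
Proof. by move=> pq qr i lt_in; rewrite pq ?qr. Qed.

Lemma eqmD (R : comNzRingType) n (p p' q q' : {poly R}) :
  eqm n p p' -> eqm n q q' -> eqm n (p + q) (p' + q').
Proof. by move=> pp' qq' i lt_in; rewrite !coefD pp' ?qq'. Qed.

Lemma eqmM (R : comNzRingType) n (p p' q q' : {poly R}) :
  eqm n p p' -> eqm n q q' -> eqm n (p * q) (p' * q').
Proof.
move=> pp' qq' i lt_in; rewrite !coefM; apply: eq_bigr => j _.
by rewrite pp' ?qq' //; have := ltn_ord j; lia.
Qed.

Lemma eqmX (R : comNzRingType) n k (p q : {poly R}) :
  eqm n p q -> eqm n (p ^+ k) (q ^+ k).
Proof. by move=> pq; elim: k => // k IHk; rewrite !exprS; apply: eqmM. Qed.

Lemma eqm_comp_Xn (R : comNzRingType) n k (p q : {poly R}) : (0 < k)%N ->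
  eqm n p q -> eqm n (p \Po 'X^k) (q \Po 'X^k).
Proof.
move=> k_gt0 pq i lt_in; rewrite !coef_comp_poly_Xn //.
by case: ifP => // _; rewrite pq //; apply: leq_ltn_trans (leq_div _ _) lt_in.
Qed.

(** A series with constant term 1 is a unit. Concretely, coefficient [i] of [u * p] is [p_i] plus
    terms in lower coefficients of [p], so strong induction applies. *)
Lemma eqm_mulI (R : comNzRingType) n (u p q : {poly R}) :
  u`_0 = 1 -> eqm n (u * p) (u * q) -> eqm n p q.
Proof.
move=> u0 upq i; elim/ltn_ind: i => i IHi lt_in.
have := upq i lt_in; rewrite !coefM !big_ord_recl /= u0 !mul1r subn0.
rewrite (eq_bigr (fun j : 'I_i => u`_(bump 0 j) * q`_(i - bump 0 j))) => [/addIr //|].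
by move=> j _; rewrite IHi // /bump; have := ltn_ord j; lia.
Qed.

(** A series in q^m multiplies each residue class of exponents modulo [m] separately. *)
Lemma coef_comp_Xn_mul (R : comNzRingType) (m s r : nat) (p q : {poly R}) : (r < m)%N ->
  ((p \Po 'X^m) * q)`_(m * s + r) =
  (p * \poly_(i < size q) q`_(m * i + r))`_s.
Proof.
move=> lt_rm; rewrite -(coefK p) poly_def raddf_sum !mulr_suml !coef_sum.
apply: eq_bigr => i _ /=; rewrite comp_polyZ comp_Xn_poly -!scalerAl !coefZ -exprM.
rewrite !coefXnM coef_poly; congr (_ * _).
have -> : (m * s + r < m * i)%N = (s < i)%N by apply/idP/idP; nia.
case: (ltnP s i) => // le_is.
have -> : (m * s + r - m * i = m * (s - i) + r)%N by nia.
case: ltnP => // le_sz; rewrite nth_default //.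
apply: leq_trans le_sz (leq_trans (leq_pmull _ _) (leq_addr _ _)).
exact: leq_ltn_trans lt_rm.
Qed.

(** * Gauss's identity *)

(* Shanks: the difference between the two sides for [n.+1] and [n] telescopes. *)
Lemma gauss_shanks (R : comNzRingType) n
    (D := fun k => \prod_(1 <= j < k.+1) (1 - 'X^(j.*2.-1)) : {poly R}) :
  (\sum_(0 <= s < n.*2) 'X^(tri s)) * D n =
  \sum_(0 <= s < n) 'X^(s * n.*2.+1) * D s * \prod_(s.+1 <= k < n.+1) (1 - 'X^(k.*2)).
Proof.
elim: n => [|n IHn]; first by rewrite !big_geq // mul0r.
have DS k : D k.+1 = D k * (1 - 'X^(k.*2.+1)) by rewrite /D big_nat_recr.
pose E s := \prod_(s.+1 <= k < n.+1) (1 - 'X^(k.*2)) : {poly R}.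
(* [G] is the telescoping certificate. In [step], the factor [1 - 'X^(n.*2.+1)] is the one that
   turns [D n] into [D n.+1] on the left. *)
pose G s := 'X^(s * n.*2.+1) * D s * (1 - 'X^(s.*2)) * E s.
have step s : (s < n)%N ->
    'X^(s * n.+1.*2.+1) * D s * \prod_(s.+1 <= k < n.+2) (1 - 'X^(k.*2)) =
    'X^(s * n.*2.+1) * D s * E s * (1 - 'X^(n.*2.+1)) + (G s.+1 - G s).
  move=> lt_sn; rewrite /G DS big_nat_recr /=; last by lia.
  have Es : E s = (1 - 'X^(s.+1.*2)) * E s.+1 by rewrite /E big_ltn.
  rewrite -/(E s) Es.
  have -> : (s * n.+1.*2.+1 = s * n.*2.+1 + s.*2)%N by lia.
  have -> : (s.+1 * n.*2.+1 = s * n.*2.+1 + n.*2 + 1)%N by lia.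
  have -> : (s.+1.*2 = s.*2 + 2)%N by lia.
  have -> : (n.+1.*2 = n.*2 + 2)%N by lia.
  rewrite -![in 'X^(_.+1)]addn1 !exprD; ring.
(* Exponents of the two terms that the left sum gains when [n] grows by one. *)
have T2 : (tri n.*2 = n * n.*2.+1)%N by have := tri_double n.*2; nia.
have T2S : (tri n.*2.+1 = n * n.*2.+1 + n.*2 + 1)%N.
  by have := tri_double n.*2.+1; nia.
rewrite doubleS [in LHS]big_nat_recr //= [in LHS]big_nat_recr //=.
rewrite [in RHS](@big_nat_recr _ _ _ n 0) //= -addrA mulrDl {1}DS mulrA IHn.
rewrite [in RHS](eq_big_nat _ _ (F2 := fun s =>
  'X^(s * n.*2.+1) * D s * E s * (1 - 'X^(n.*2.+1)) + (G s.+1 - G s))); last first.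
  by move=> s /andP[_ lt_sn]; rewrite step.
rewrite big_split /= telescope_sumr // -mulr_suml -/(E _) -!addrA; congr (_ + _).
have G0 : G 0 = 0 by rewrite /G double0 expr0 subrr mulr0 mul0r.
rewrite big_nat1 G0 oppr0 add0r /G DS T2 T2S.
have -> : E n = 1 by rewrite /E big_geq.
have -> : (n * n.*2.+3 = n * n.*2.+1 + n.*2)%N by lia.
have -> : (n.+1.*2 = n.*2 + 2)%N by lia.
by rewrite -![in 'X^(_.+1)]addn1 !exprD; ring.
Qed.

(** * Power series modulo 2 *)

Lemma addF2 (p : {poly 'F_2}) : p + p = 0.
Proof. by rewrite -mulr2n -scaler_nat [2%:R](_ : _ = 0) ?scale0r //; apply/val_inj. Qed.

Lemma oppF2 (p : {poly 'F_2}) : - p = p.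
Proof. by apply/eqP; rewrite eq_sym -subr_eq0 opprK addF2. Qed.

Lemma sqrD_F2 (p q : {poly 'F_2}) : (p + q) ^+ 2 = p ^+ 2 + q ^+ 2.
Proof. by rewrite sqrrD mulr2n addF2 addr0. Qed.

(** Frobenius: the cross terms vanish and squaring fixes every coefficient in F_2. *)
Lemma sqr_F2 (p : {poly 'F_2}) : p ^+ 2 = p \Po 'X^2.
Proof.
elim/poly_ind: p => [|p c IHp]; first by rewrite comp_poly0 expr0n.
rewrite comp_polyD comp_polyM comp_polyX comp_polyC sqrD_F2 exprMn IHp.
by rewrite -polyC_exp; congr (_ + _%:P); case: c => [[|[|[]]]] // lt_c; apply: val_inj.
Qed.

Lemma coef_sqrD_even (p q : {poly 'F_2}) k : (p ^+ 2 + 'X * q ^+ 2)`_k.*2 = p`_k.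
Proof.
rewrite (sqr_F2 p) (sqr_F2 q) coefD coefXM !coef_comp_poly_Xn // double_eq0.
case: k => [|k] /=; first by rewrite addr0.
by rewrite !dvdn2 /= odd_double addr0 -muln2 mulnK.
Qed.

Lemma coef_sqrD_odd (p q : {poly 'F_2}) k : (p ^+ 2 + 'X * q ^+ 2)`_k.*2.+1 = q`_k.
Proof.
rewrite (sqr_F2 p) (sqr_F2 q) coefD coefXM !coef_comp_poly_Xn //= dvdn2 /= odd_double add0r.
by rewrite dvdn2 odd_double -muln2 mulnK.
Qed.

(** Since [a <= tri a], the terms with [a < M] give all coefficients of the series psi below degree
    [M]. *)
Definition psi M : {poly 'F_2} := \sum_(a < M) 'X^(tri a).

Lemma coef_psi M k : (k < M)%N -> (psi M)`_k = (is_tri k)%:R.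
Proof.
move=> lt_kM; rewrite coef_sum; case: is_triP => [[a ak]|no_a].
  have lt_aM : (a < M)%N by apply: leq_ltn_trans lt_kM; rewrite -ak leq_tri.
  rewrite (bigD1 (Ordinal lt_aM)) //= coefXn ak eqxx big1 ?addr0 // => b neq_b.
  rewrite coefXn -ak; case: eqP => // /tri_inj ab; case/eqP: neq_b; exact/val_inj.
by rewrite big1 // => b _; rewrite coefXn; case: eqP => // kb; case: no_a; exists b.
Qed.

Definition euler n : {poly 'F_2} := \prod_(1 <= j < n.+1) (1 + 'X^j).

Lemma eqm_prod1 (R : comNzRingType) n (r : seq nat) (F : nat -> {poly R}) :
  (forall k, k \in r -> eqm n (F k) 1) -> eqm n (\prod_(k <- r) F k) 1.
Proof.
move=> F1; rewrite big_seq; elim/big_rec: _ => // k p k_r IHp.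
by rewrite -[1]mulr1; apply: eqmM; first exact: F1.
Qed.

Lemma eqm_1DXn n k : (n <= k)%N -> eqm n (1 + 'X^k : {poly 'F_2}) 1.
Proof.
move=> le_nk i lt_in; rewrite coefD coefXn ltn_eqF ?addr0 //.
exact: leq_trans le_nk.
Qed.

Lemma coef0_1DXn (R : comNzRingType) k : (0 < k)%N -> (1 + 'X^k : {poly R})`_0 = 1.
Proof. by case: k => // k _; rewrite coefD coefXn coef1 /= addr0. Qed.

Lemma coef0_euler n : (euler n)`_0 = 1.
Proof.
rewrite coef0_prod big_nat big1 // => j /andP[j_gt0 _]; exact: coef0_1DXn.
Qed.

Lemma euler_split n :
  (\prod_(1 <= j < n.+1) (1 - 'X^(j.*2.-1))) * (\prod_(1 <= j < n.+1) (1 - 'X^(j.*2)))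
  = euler n.*2.
Proof.
rewrite /euler; elim: n => [|n IHn]; first by rewrite !big_geq // mulr1.
rewrite doubleS [RHS]big_nat_recr //= [in RHS]big_nat_recr //= -IHn.
rewrite [X in X * _]big_nat_recr //= [X in _ * X]big_nat_recr //=.
rewrite doubleS /= !oppF2; ring.
Qed.

(** Modulo ['X^(n.+1)], Shanks's identity reads psi D = E, where E is the square of [euler n] by
    Frobenius and D E is [euler n.*2], congruent to [euler n]. Then euler^4 = E E = psi D E = psi
    euler, and [euler n] cancels. *)
Lemma euler_cube n : (0 < n)%N -> eqm n.+1 (euler n ^+ 3) (psi n.*2).
Proof.
move=> n_gt0.
set D := \prod_(1 <= j < n.+1) (1 - 'X^(j.*2.-1) : {poly 'F_2}).
set E := \prod_(1 <= j < n.+1) (1 - 'X^(j.*2) : {poly 'F_2}).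
have E_sq : E = euler n ^+ 2.
  rewrite -prodrXl; apply: eq_bigr => j _.
  by rewrite oppF2 sqrD_F2 expr1n -exprM muln2.
have psiD : eqm n.+1 (psi n.*2 * D) E.
  have -> : psi n.*2 = \sum_(0 <= s < n.*2) 'X^(tri s) by rewrite big_mkord.
  (* Only [s = 0] survives on the right: for [s > 0] the exponent [s * n.*2.+1] exceeds [n]. *)
  rewrite gauss_shanks big_ltn // mul0n expr0 mul1r big_geq // mul1r -[X in eqm _ _ X]addr0.
  apply: eqmD => // i lt_in; rewrite coef0 coef_sum big_nat big1 // => s /andP[s_gt0 _].
  by rewrite -mulrA coefXnM ifT //; nia.
have euler2 : eqm n.+1 (euler n.*2) (euler n).
  rewrite /euler (@big_cat_nat _ _ _ n.+1) //=; last by lia.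
  rewrite -[X in eqm _ _ X]mulr1; apply: eqmM => //; apply: eqm_prod1 => k.
  by rewrite mem_index_iota => /andP[le_nk _]; apply: eqm_1DXn.
apply: (@eqm_mulI _ _ (euler n)); first exact: coef0_euler.
apply: (@eqm_trans _ _ (E * E)); first by rewrite E_sq -exprS -exprD.
apply: (@eqm_trans _ _ (psi n.*2 * D * E)); first by apply: eqmM => //; apply: eqm_sym.
by rewrite -mulrA euler_split mulrC; apply: eqmM.
Qed.

(** * The product of psi(q) and psi(q^3) *)

(** The points moved by [f] form pairs whose contributions cancel in F_2; comparing [enum_rank]
    selects one member of each pair. *)
Lemma sum1_involution (I : finType) (P : pred I) (f : I -> I) :
  (forall i, P i -> P (f i)) -> (forall i, P i -> f (f i) = i) ->
  \sum_(i | P i) 1 = \sum_(i | P i && (f i == i)) 1 :> 'F_2.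
Proof.
move=> Pf fK; rewrite (bigID (fun i => f i == i)) /= -[RHS]addr0; congr (_ + _).
rewrite (bigID (fun i => enum_rank (f i) < enum_rank i)%N) /=.
have add2 (x : 'F_2) : x + x = 0.
  by case: x => [[|[|[]]]] // lt_x; apply/val_inj.
set Q := fun i => P i && (f i != i) && ~~ (enum_rank (f i) < enum_rank i)%N.
apply: etrans (add2 (\sum_(i | Q i) 1)); rewrite {}/Q.
congr (_ + _); rewrite (reindex_onto f f) => [|i /andP[/andP[Pi _] _]]; last exact: fK.
apply: eq_bigl => i; apply/idP/idP.
  case/andP=> /andP[/andP[Pfi neq] lt_i] /eqP ffi; have Pi : P i by rewrite -ffi Pf.
  have neq' : f i != i by apply: contra neq => /eqP fi; rewrite fi fi.
  by rewrite Pi neq' /= -leqNgt ltnW // -{1}ffi.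
case/andP=> /andP[Pi neq]; rewrite -leqNgt leq_eqVlt => lt_i.
rewrite Pf ?fK // eqxx eq_sym neq andbT /=.
by case/orP: lt_i => // /eqP/ord_inj/enum_rank_inj fi; rewrite -fi eqxx in neq.
Qed.

(* With [x = 2a+1], [y = 2b+1], the form [x^2 + 3y^2] is invariant under the involution
   [(x, y) |-> ((x+3y)/2, (x-y)/2)]; its sign is chosen by flipping [y] so that
   [x - y] is [2] modulo [4], and absolute values are taken in the result. *)
Definition tri_flip (p : nat * nat) : nat * nat :=
  let: (a, b) := p in
  if odd (a + b) then
    ((a + 3 * b).+1./2, if (b < a)%N then (a - b).-1./2 else (b - a).-1./2)
  else (if (3 * b < a)%N then (a - 3 * b).-2./2 else (3 * b - a)./2, (a + b)./2).

Lemma tri_flipK : involutive tri_flip.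
Proof.
case=> a b; rewrite /tri_flip.
by case: (ltnP b a) => ?; case: (ltnP (3 * b) a) => ?;
 repeat (case: ifP => ?); congr (_, _); lia.
Qed.

Lemma tri_flip_sum p :
  (tri (tri_flip p).1 + 3 * tri (tri_flip p).2 = tri p.1 + 3 * tri p.2)%N.
Proof.
suff E x y a b : (x * x.+1 + 3 * (y * y.+1) = a * a.+1 + 3 * (b * b.+1) ->
    tri x + 3 * tri y = tri a + 3 * tri b)%N.
  case: p => a b /=.
  case: ifP => odd_ab /=; case: ifP => lt_ab; apply: E.
  - have [d ->] : exists d, a = (b + d.*2.+1)%N by exists (a - b).-1./2; lia.
    have -> : uphalf (b + d.*2.+1 + 3 * b) = (2 * b + d.+1)%N by lia.
    have -> : (b + d.*2.+1 - b).-1./2 = d by lia.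
    nia.
  - have [d ->] : exists d, b = (a + d.*2.+1)%N by exists (b - a).-1./2; lia.
    have -> : uphalf (a + 3 * (a + d.*2.+1)) = (2 * a + 3 * d + 2)%N by lia.
    have -> : (a + d.*2.+1 - a).-1./2 = d by lia.
    nia.
  - have [d ->] : exists d, a = (3 * b + d.*2.+2)%N by exists (a - 3 * b).-2./2; lia.
    have -> : (3 * b + d.*2.+2 - 3 * b).-2./2 = d by lia.
    have -> : (3 * b + d.*2.+2 + b)./2 = (2 * b + d.+1)%N by lia.
    nia.
  - have [dd cc] : (a + (3 * b - a)./2.*2 = 3 * b /\
      (a + b)./2 + (3 * b - a)./2 = 2 * b)%N by lia.
    move: (_./2) (_./2) dd cc => c d dd cc.
    (* Here [a = 3b - 2d] and [c = 2b - d]; writing the larger of [b], [d] as the other plus [e]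
       removes all subtractions. *)
    case: (leqP d b) => db.
    + have [e be] : exists e, b = (d + e)%N by exists (b - d)%N; lia.
      have -> : a = (d + 3 * e)%N by lia.
      have -> : c = (d + 2 * e)%N by lia.
      rewrite be; nia.
    + have [e be] : exists e, d = (b + e)%N by exists (d - b)%N; lia.
      have bE : b = (a + 2 * e)%N by lia.
      have -> : c = (a + e)%N by lia.
      rewrite be bE; nia.
move=> H; have := tri_double x; have := tri_double y.
by have := tri_double a; have := tri_double b; lia.
Qed.

(** In terms of x = 2a+1 and y = 2b+1, the fixed points are x = y and x = 3y. *)
Lemma tri_flip_fix a b : (tri_flip (a, b) == (a, b)) = (a == b) || (a == (3 * b).+1).
Proof.
rewrite /tri_flip; case: (ltnP b a) => ?; case: (ltnP (3 * b) a) => ?;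
  case: ifP => ?; rewrite xpair_eqE; lia.
Qed.

Arguments tri_flip _ : simpl never.

(** Coefficient [k] on the left is the parity of the number of pairs with [tri a + 3 * tri b = k],
    so only fixed points of [tri_flip] count. Those with [a = b] have [k = 4 * tri b] and give
    psi(q^4) = psi^4; those with [a = 3 * b + 1] have [k = 12 * tri b + 1] and give q psi(q^12). *)
Lemma psi_psi3 M : (0 < M)%N ->
  eqm M (psi M * (psi M \Po 'X^3)) (psi M ^+ 4 + 'X * (psi M \Po 'X^3) ^+ 4).
Proof.
case: M => // M _ k lt_kM.
have psi4 (p : {poly 'F_2}) : p ^+ 4 = p \Po 'X^4.
  by rewrite (exprM p 2 2) sqr_F2 (sqr_F2 p) -comp_polyA comp_Xn_poly -exprM.
have psi3E : psi M.+1 \Po 'X^3 = \sum_(b < M.+1) 'X^(3 * tri b).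
  by rewrite raddf_sum; apply: eq_bigr => b _; rewrite /= comp_Xn_poly -exprM.
pose P (p : 'I_M.+1 * 'I_M.+1) := (tri p.1 + 3 * tri p.2 == k)%N.
have -> : (psi M.+1 * (psi M.+1 \Po 'X^3))`_k = \sum_(p | P p) 1.
  rewrite psi3E mulr_suml coef_sum [RHS]big_mkcond.
  rewrite -(pair_bigA _ (fun a b => if P (a, b) then 1 else 0)) /=.
  apply: eq_bigr => a _; rewrite mulr_sumr coef_sum; apply: eq_bigr => b _.
  by rewrite -exprD coefXn /P /= eq_sym; case: eqP.
(* [inord] is faithful on pairs satisfying [P]: the flipped coordinates are at most [k], hence at
   most [M]. *)
pose f (p : 'I_M.+1 * 'I_M.+1) : 'I_M.+1 * 'I_M.+1 :=
  let q := tri_flip (val p.1, val p.2) in (inord q.1, inord q.2).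
have fE p : P p -> (val (f p).1, val (f p).2) = tri_flip (val p.1, val p.2).
  move=> /eqP Pp; have := tri_flip_sum (val p.1, val p.2); rewrite /= Pp /f /=.
  case: (tri_flip _) => x y /= xy; have := leq_tri x; have := leq_tri y => ? ?.
  by rewrite !inordK //; lia.
have ff p : P p -> P (f p).
  move=> Pp; have := fE p Pp; have := tri_flip_sum (val p.1, val p.2).
  by rewrite /= (eqP Pp) /P => + e; rewrite -e => ->.
have fK p : P p -> f (f p) = p.
  move=> Pp; have e := fE p Pp; have := fE (f p) (ff p Pp); rewrite e tri_flipK.
  case: (f (f p)) => c d; case: p {Pp e} => a b [/val_inj -> /val_inj ->] //.
pose fixed (a b : 'I_M.+1) := (val a == val b) || (val a == (3 * val b).+1).
rewrite (sum1_involution ff fK) (eq_bigl (fun p => P p && fixed p.1 p.2)); last first.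
  by move=> p; case Pp: (P p) => //=; rewrite /fixed -tri_flip_fix -fE.
rewrite (psi4 (psi _)) (psi4 (psi _ \Po _)) big_mkcond.
rewrite -(pair_bigA _ (fun a b => if P (a, b) && fixed a b then 1 else 0)).
rewrite exchange_big /fixed /=.
rewrite coefD coefXM -comp_polyA comp_Xn_poly -exprM.
rewrite !raddf_sum /= !coef_sum.
have -> : (if k == 0%N then 0 else
    \sum_(b < M.+1) ('X^(tri b) \Po 'X^(4 * 3) : {poly 'F_2})`_k.-1)
  = \sum_(b < M.+1) ((12 * tri b).+1 == k)%:R.
  case: eqP => [->|k0]; first by rewrite big1.
  apply: eq_bigr => b _; rewrite comp_Xn_poly -exprM coefXn; congr (nat_of_bool _)%:R.
  by apply/eqP/eqP; lia.
rewrite -big_split /=; apply: eq_bigr => b _.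
rewrite comp_Xn_poly -exprM coefXn.
rewrite (bigD1 b) //= eqxx /= andbT; congr (_ + _).
  by rewrite /P /= -mulSn eq_sym; case: eqP.
rewrite (eq_bigr (fun a : 'I_M.+1 =>
  if (val a == (3 * b).+1) && ((12 * tri b).+1 == k) then 1 else 0)); last first.
  move=> a ne_ab; have -> : (val a == val b) = false by apply/negbTE.
  rewrite orFb; case: (eqVneq (val a) (3 * b).+1) => [ea|_]; last by rewrite andbF.
  rewrite andbT /P /= ea.
  by rewrite tri3S; congr (if _ then _ else _); apply/eqP/eqP; lia.
case: eqP => [kb|_]; last by rewrite big1 // => a _; rewrite andbF.
have lt_b : ((3 * b).+1 < M.+1)%N by have := leq_tri b; lia.
rewrite (bigD1 (Ordinal lt_b)) /=; last by apply/eqP => /(congr1 val) /=; lia.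
rewrite eqxx big1 ?addr0 // => a /andP[_ ne]; rewrite ifF // andbT.
by apply: contraNF ne => /eqP eq_a; apply/eqP/val_inj.
Qed.

(** * Reduction of the Hauptmodul modulo 2 *)

Definition trunc2 n (f : ps) : {poly 'F_2} := \poly_(i < n) (f i)%:~R.

Lemma coef_trunc2 n f i : (i < n)%N -> (trunc2 n f)`_i = (f i)%:~R.
Proof. by move=> lt_in; rewrite coef_poly lt_in. Qed.

Lemma trunc2_one n : eqm n (trunc2 n ps_one) 1.
Proof. by move=> i lt_in; rewrite coef_trunc2 // coef1 /ps_one; case: eqP. Qed.

Lemma trunc2_mul n f g : eqm n (trunc2 n (ps_mul f g)) (trunc2 n f * trunc2 n g).
Proof.
move=> i lt_in; rewrite coef_trunc2 // coefM rmorph_sum; apply: eq_bigr => j _ /=.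
by rewrite rmorphM !coef_trunc2 //; have := ltn_ord j; lia.
Qed.

Lemma trunc2_exp n f e : eqm n (trunc2 n (ps_exp f e)) (trunc2 n f ^+ e).
Proof.
elim: e => [|e IHe]; first exact: trunc2_one.
rewrite exprS; apply: (eqm_trans (@trunc2_mul _ _ _)).
by apply: eqmM.
Qed.

Lemma trunc2_onem n k : (0 < k)%N -> eqm n (trunc2 n (ps_onem k)) (1 + 'X^k).
Proof.
move=> k_gt0 i lt_in; rewrite coef_trunc2 // coefD coef1 coefXn /ps_onem.
case: eqP => [->|_]; first by rewrite eq_sym eqn0Ngt k_gt0 addr0.
by case: eqP => _; rewrite add0r //; apply/val_inj.
Qed.

Lemma trunc2_geom n k : (0 < k)%N -> eqm n (trunc2 n (ps_geom k) * (1 + 'X^k)) 1.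
Proof.
move=> k_gt0 i lt_in; rewrite mulrDr mulr1 coefD coefMXn coef1 coef_trunc2 // /ps_geom.
case: ltnP => [lt_ik|le_ki].
  rewrite addr0; case: (posnP i) => [->|i_gt0]; first by rewrite dvdn0.
  by rewrite gtnNdvd // eqn0Ngt i_gt0.
rewrite coef_trunc2; last by apply: leq_ltn_trans lt_in; rewrite leq_subr.
have -> : (i == 0%N) = false by lia.
rewrite -{1}(subnK le_ki) dvdn_addl //.
by case: (k %| _)%N; apply/val_inj.
Qed.

(* Modulo 2, [1 - q^(2j)] is [(1 - q^j)^2], so each factor is an inverse sixth power. *)
Lemma trunc2_P_factor n j : (0 < j)%N ->
  eqm n (trunc2 n (P_factor j) * ((1 + 'X^j) * (1 + 'X^(3 * j))) ^+ 6) 1.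
Proof.
move=> j_gt0; set u := 1 + 'X^j; set v := 1 + 'X^(3 * j).
have dbl k : (1 + 'X^(2 * k) : {poly 'F_2}) = (1 + 'X^k) ^+ 2.
  by rewrite sqrD_F2 expr1n -exprM mulnC.
have [j3 j2 j6] : [/\ (0 < 3 * j)%N, (0 < 2 * j)%N & (0 < 6 * j)%N] by split; lia.
set gu := trunc2 n (ps_geom (2 * j)); set gv := trunc2 n (ps_geom (6 * j)).
have gu1 : eqm n (gu * u ^+ 2) 1 by rewrite -dbl; apply: trunc2_geom.
have gv1 : eqm n (gv * v ^+ 2) 1 by rewrite -dbl mulnA; apply: trunc2_geom.
have PE : eqm n (trunc2 n (P_factor j)) ((u ^+ 6 * v ^+ 6) * (gu ^+ 6 * gv ^+ 6)).
  apply: (eqm_trans (@trunc2_mul _ _ _)); apply: eqmM.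
    apply: (eqm_trans (@trunc2_mul _ _ _)); apply: eqmM;
      by apply: (eqm_trans (@trunc2_exp _ _ _)); apply: eqmX; apply: trunc2_onem.
  by apply: (eqm_trans (@trunc2_mul _ _ _)); apply: eqmM; apply: trunc2_exp.
apply: (eqm_trans (eqmM PE (@eqm_refl _ _ _))).
have -> : u ^+ 6 * v ^+ 6 * (gu ^+ 6 * gv ^+ 6) * (u * v) ^+ 6 =
  (gu * u ^+ 2) ^+ 6 * (gv * v ^+ 2) ^+ 6 by ring.
by have := eqmM (eqmX 6 gu1) (eqmX 6 gv1); rewrite !expr1n mulr1.
Qed.

Lemma trunc2_P n : eqm n.+1 (trunc2 n.+1 (ps_prod P_factor n) *
  (euler n * (euler n \Po 'X^3)) ^+ 6) 1.
Proof.
have prodE : eqm n.+1 (trunc2 n.+1 (ps_prod P_factor n))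
    (\prod_(j <- iota 1 n) trunc2 n.+1 (P_factor j)).
  rewrite /ps_prod; elim: (iota 1 n) => [|j s IHs] /=.
    by rewrite big_nil; apply: trunc2_one.
  by rewrite big_cons; apply: (eqm_trans (@trunc2_mul _ _ _)); apply: eqmM.
have -> : (euler n * (euler n \Po 'X^3)) ^+ 6 =
    \prod_(j <- iota 1 n) ((1 + 'X^j) * (1 + 'X^(3 * j))) ^+ 6.
  rewrite prodrXl big_split /= /euler /index_iota subn1; congr ((_ * _) ^+ _).
  rewrite rmorph_prod; apply: eq_bigr => j _.
  by rewrite /= comp_polyD comp_Xn_poly -exprM comp_polyC.
apply: (eqm_trans (eqmM prodE (@eqm_refl _ _ _))).
rewrite -big_split /=; apply: eqm_prod1 => j.
by rewrite mem_iota => /andP[j_gt0 _]; apply: trunc2_P_factor.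
Qed.

(** The sixth power is the square of a cube, and [euler_cube] replaces each cube by psi. *)
Lemma P_psi n : (0 < n)%N -> eqm n.+1 (trunc2 n.+1 (ps_prod P_factor n) *
  (psi n.*2 * (psi n.*2 \Po 'X^3)) ^+ 2) 1.
Proof.
move=> n_gt0; apply: eqm_trans (@trunc2_P n); apply: eqmM => //.
rewrite [X in eqm _ _ X](exprM _ 3 2); apply: eqmX; rewrite exprMn; apply: eqmM.
  exact/eqm_sym/euler_cube.
by rewrite -rmorphXn /=; apply: eqm_comp_Xn => //; apply/eqm_sym/euler_cube.
Qed.

(** * Two progressions of coefficients of 1/(psi psi3)^2 *)

Lemma coef_inv_psi n (P : {poly 'F_2}) (f := psi n.*2) (g := f \Po 'X^3) t : (0 < n)%N ->
  eqm n.+1 (P * (f * g) ^+ 2) 1 ->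
  ((8 * t + 2 <= n)%N -> P`_(8 * t + 2) = f`_t) /\
  ((24 * t + 4 <= n)%N -> P`_(24 * t + 4) = f`_t).
Proof.
move=> n_gt0 P1.
have fg : eqm n.+1 (f * g) (f ^+ 4 + 'X * g ^+ 4).
  move=> i lt_in; rewrite psi_psi3 ?double_gt0 //; lia.
have f0 : f`_0 = 1.
  rewrite coef_psi ?double_gt0 //; have -> : is_tri 0 by apply/is_triP; exists 0%N.
  by [].
have g0 : g`_0 = 1 by rewrite coef_comp_poly_Xn.
(* Up to degree [n], these are U = 1/(f g), V = g/f and Z = f/g = 1/V. *)
pose U := P * (f * g); pose V := U * g ^+ 2; pose Z := U * f ^+ 2.
have Ufg : eqm n.+1 (U * (f * g)) 1 by rewrite -mulrA -expr2.
have PU : eqm n.+1 P (U ^+ 2).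
  have -> : U ^+ 2 = P * (P * (f * g) ^+ 2) by rewrite /U; ring.
  by rewrite -{1}[P]mulr1; apply: eqmM => //; apply: eqm_sym.
have UE : eqm n.+1 U (Z ^+ 2 + 'X * V ^+ 2).
  have -> : Z ^+ 2 + 'X * V ^+ 2 = U ^+ 2 * (f ^+ 4 + 'X * g ^+ 4).
    by rewrite /Z /V; ring.
  apply: (@eqm_trans _ _ (U * (U * (f * g)))).
    by rewrite -{1}[U]mulr1; apply: eqmM => //; apply: eqm_sym.
  by rewrite mulrA -expr2; apply: eqmM.
have fV : eqm n.+1 (f * V) g.
  have -> : f * V = (U * (f * g)) * g by rewrite /V; ring.
  by rewrite -[X in eqm _ _ X]mul1r; apply: eqmM.
have gZ : eqm n.+1 (g * Z) f.
  have -> : g * Z = (U * (f * g)) * f by rewrite /Z; ring.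
  by rewrite -[X in eqm _ _ X]mul1r; apply: eqmM.
(* This is f g = f^4 + q g^4 divided by f^2, with g = f V. Its even part gives [V2]. *)
have VE : eqm n.+1 V (f ^+ 2 + 'X * (f * V ^+ 2) ^+ 2).
  apply: (@eqm_mulI _ _ (f ^+ 2)); first by rewrite expr2 coef0M f0 mulr1.
  have -> : f ^+ 2 * V = f * (f * V) by ring.
  have -> : f ^+ 2 * (f ^+ 2 + 'X * (f * V ^+ 2) ^+ 2) = f ^+ 4 + 'X * (f * V) ^+ 4 by ring.
  apply: (eqm_trans (eqmM (@eqm_refl _ _ f) fV)); apply: (eqm_trans fg).
  by apply: eqmD => //; apply: eqmM => //; apply: eqmX; apply: eqm_sym.
have V2 r : (r.*2 < n.+1)%N -> V`_r.*2 = f`_r.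
  by move=> lt_rn; rewrite VE // coef_sqrD_even.
have P2 r : (r.*2 < n.+1)%N -> P`_r.*2 = U`_r.
  by move=> lt_rn; rewrite PU //; have := coef_sqrD_even U 0 r; rewrite expr0n mulr0 addr0.
split=> le_tn.
  (* The index descends from [8t+2] in P to [4t+1] in U, then [2t] in V, then [t] in f. *)
  rewrite (_ : 8 * t + 2 = (t.*2.*2.+1).*2)%N; last by lia.
  rewrite P2; last by lia.
  by rewrite UE ?coef_sqrD_odd ?V2 //; lia.
(* The index descends from [24t+4] in P to [12t+2] in U, then [6t+1 = 3(2t)+1] in Z. The class 1
   modulo 3 of Z is [W], to be matched with V at [2t]. *)
rewrite (_ : 24 * t + 4 = ((3 * t.*2 + 1).*2.*2))%N; last by lia.
rewrite P2; last by lia.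
rewrite UE ?coef_sqrD_even; last by lia.
pose W := \poly_(i < size Z) Z`_(3 * i + 1).
rewrite (_ : Z`_(3 * t.*2 + 1) = W`_t.*2); last first.
  rewrite coef_poly; case: ltnP => // le_sz; rewrite nth_default //.
  by apply: leq_trans le_sz _; lia.
rewrite -V2; last by lia.
(* After multiplication by [f], the relations g Z = f and f V = g reduce W = V to this: [3i+1] is
   triangular exactly when [i] is three times a triangular number. *)
apply: (@eqm_mulI _ t.*2.+1 f) => // i lt_i.
rewrite -coef_comp_Xn_mul // -/g gZ; last by lia.
rewrite fV; last by lia.
rewrite coef_comp_poly_Xn // !coef_psi; try lia.
case: ifP => [/dvdnP[s ->]|ndvd].
  rewrite mulnK //.
  congr (nat_of_bool _)%:R; apply/is_triP/is_triP => -[a aE]; last first.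
    by exists (3 * a).+1; rewrite tri3S; lia.
  have [b ab] := mod3_cases a; exists b.
  have := tri3 b; have := tri3S b; have := tri3SS b.
  by case: ab aE => [|[]] -> ->; lia.
case: is_triP => // -[a aE].
suff : (3 %| i)%N by rewrite ndvd.
have [b ab] := mod3_cases a; apply/dvdnP; exists (3 * tri b)%N.
have := tri3 b; have := tri3S b; have := tri3SS b.
by case: ab aE => [|[]] -> ->; lia.
Qed.

(** * Density of the exceptional indices *)

(** If [tri c.-1] exceeded [N], every triangular number up to [N] would have index below [c.-1],
    leaving at most [c.-1] of them. *)
Lemma count_is_tri N (c := count is_tri (iota 0 N.+1)) : (c * c.-1 <= N.*2)%N.
Proof.
have cE : c = size [seq k <- iota 0 N.+1 | is_tri k] by rewrite size_filter.
have [->//|c_gt0] := posnP c.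
suff : (tri c.-1 <= N)%N by have := tri_double c.-1; rewrite prednK //; lia.
rewrite leqNgt; apply/negP => lt_N.
have : (c <= size [seq tri a | a <- iota 0 c.-1])%N.
  rewrite {1}cE; apply: uniq_leq_size; first exact/filter_uniq/iota_uniq.
  move=> k; rewrite mem_filter mem_iota => /andP[/is_triP[a <-] le_aN].
  apply: map_f; rewrite mem_iota add0n.
  by case: (ltngtP a c.-1) => // [/ltn_tri|ea]; [lia | rewrite -ea in lt_N; lia].
by rewrite size_map size_iota; lia.
Qed.

(** As [k > 0], the constant 6 is absent, and 64 vanishes modulo 2. What remains is [Pcoef k.+1],
    with [k.+1] equal to [8t+2] or [24t+4]. *)
Lemma even_J6star m t : (m <= 1)%N -> ~~ is_tri t ->
  (2 %| J6star (3 ^ m * (8 * t + 1)))%Z.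
Proof.
move=> m_le1 not_tri; set k := (3 ^ m * (8 * t + 1))%N.
have k_gt0 : (0 < k)%N by rewrite muln_gt0 expn_gt0 addn1.
have Pk : (Pcoef k.+1)%:~R = 0 :> 'F_2.
  rewrite /Pcoef -(@coef_trunc2 k.+2) //.
  have [P8 P24] := coef_inv_psi t (isT : (0 < k.+1)%N) (P_psi (isT : (0 < k.+1)%N)).
  have tE : (psi k.+1.*2)`_t = 0.
    rewrite coef_psi ?(negbTE not_tri) // /k; case: m {m_le1 k k_gt0 P8 P24} => [|m].
      by rewrite mul1n; lia.
    rewrite expnS; have := expn_gt0 3 m; nia.
  case: m m_le1 @k {k_gt0} P8 P24 tE => [|[|//]] _ k P8 P24 tE.
    have kE : k.+1 = (8 * t + 2)%N by rewrite /k expn0; lia.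
    by rewrite -kE in P8; rewrite P8.
  have kE : k.+1 = (24 * t + 4)%N by rewrite /k expn1; lia.
  by rewrite -kE in P24; rewrite P24.
rewrite (@dvdz_pcharf 'F_2 2) ?pchar_Fp // /J6star.
rewrite !rmorphD /= Pk (gtn_eqF k_gt0) !add0r rmorphM /=.
by rewrite (_ : 64%:~R = 0 :> 'F_2) ?mul0r //; apply/val_inj.
Qed.

Theorem theorem1p1 (R : realType) (m : nat) (hm : (m <= 1)%N) :
  (count (fun n : nat => (2 %| J6star (3 ^ m * (8 * n + 1)))%Z)
         (iota 0 (Num.truncn X).+1))%:R / X @[X --> +oo] --> (1 : R).
Proof.
apply/cvgrPdist_le => e e_gt0; near=> X.
have X_gt1 : 1 <= X by near: X; exact: nbhs_pinfty_ge.
have eX : 2 <= e * X.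
  by rewrite mulrC -ler_pdivrMr //; near: X; exact: nbhs_pinfty_ge.
have e2X : 4 <= e * (e * X).
  by rewrite mulrA mulrC -ler_pdivrMr ?mulr_gt0 //; near: X; exact: nbhs_pinfty_ge.
set N := Num.truncn X; set ev := fun n => _; set c := count ev _.
pose d := count is_tri (iota 0 N.+1).
have le_c : (c <= N.+1)%N by rewrite -[X in (_ <= X)%N](size_iota 0) count_size.
have ge_c : (N.+1 <= c + d)%N.
  rewrite -[X in (X <= _)%N](size_iota 0) -(count_predC is_tri) addnC leq_add2r.
  by apply: sub_count => n; apply: even_J6star.
have d2 := count_is_tri N; rewrite -/d in d2.
have /andP[NX XN] : N%:R <= X < N.+1%:R by apply: truncn_itv; lra.
(* If [d > e * X >= 2], then [d - 1 >= d / 2], so d(d-1) exceeds (eX)^2/2, which is at least 2X by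
   [e2X]; yet d(d-1) is at most 2N. *)
have dX : d%:R <= e * X.
  rewrite leNgt; apply/negP => lt_d.
  have d_gt0 : (0 < d)%N by rewrite -(ltr0n R); lra.
  have : (d%:R * (d%:R - 1)) <= 2 * X :> R.
    apply: le_trans (_ : 2 * N%:R <= _); last by lra.
    rewrite -{2}(prednK d_gt0) -natr1 addrK -natrM -natrM ler_nat; lia.
  have : 4 * X <= (e * X) ^+ 2 by rewrite exprMn expr2 [X in _ <= X]mulrA; nra.
  by nra.
have X_gt0 : 0 < X by lra.
(* The bounds [N + 1 - d <= c <= N + 1] place [c] within [e * X] of [X]. *)
rewrite -(ler_nat R) in le_c; rewrite -(ler_nat R) natrD in ge_c.
rewrite -natr1 in le_c, ge_c, XN.
rewrite -(ler_pM2r X_gt0) -{2}(gtr0_norm X_gt0) -normrM mulrBl mul1r divfK ?gt_eqF //.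
rewrite ler_norml; apply/andP; split; lra.
Unshelve. all: by end_near.
Qed.
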